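(* Restricted to instances with $k_{\#} \geq 1$, any deterministic algorithm for the minimum, sorting, or MST problem under uncertainty has competitive ratio $\rho\geq 2$.
   Context: Each uncertain element $i$ has an interval $I_i$ that is open $(L_i,U_i)$ or trivial $\{w_i\}$, an unknown true value $w_i\in I_i$ (revealed by a query) and a predicted value $\bar w_i\in I_i$. Minimum problem: given intervals and a family $\mathcal{S}$ of subsets, determine for each set an element of minimum true value. Sorting problem: determine for each set the order by true value. MST problem: graph with an interval and prediction per edge weight; determine a spanning tree that is an MST for the true weights. A query set is feasible if the answer is the same for all value assignments in the intervals agreeing with the true values on it; $\mathrm{opt}$ is the minimum size of a feasible query set. An adaptive algorithm stops once its queries are feasible; it has competitive ratio $\rho$ on a class of instances if $|\mathrm{ALG}|\le\rho\cdot\mathrm{opt}$ on every instance of the class. $k_{\#}=|\{i: w_i\ne\bar w_i\}|$ is the number of inaccurate predictions. *)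

(* Defs.v *)
From HB Require Import structures.
From mathcomp Require Import all_boot all_order all_algebra.
From mathcomp Require Import boolp reals.

Set Implicit Arguments.
Unset Strict Implicit.
Unset Printing Implicit Defensive.

Import Order.TTheory GRing.Theory Num.Theory.
Local Open Scope ring_scope.

(* A problem is given by its combinatorial structures (e.g. a set family or a
   graph), the uncertain elements of a structure, and the relation
   [correct s w a]: the answer a solves s when the elements have values w. *)
Record problem (R : realType) := Problem {
  structure : Type;
  elt : structure -> finType;
  valid : structure -> Prop;
  answer : structure -> Type;
  correct : forall s : structure, (elt s -> R) -> answer s -> Prop }.

Section Uncertainty.
Variables (R : realType) (P : problem R).

(* What the algorithm knows before making any query. *)
Record input := Input {
  base : structure P;
  itv : elt base -> interval R;
  predicted : elt base -> R }.

Definition open_or_trivial (I : interval R) : Prop :=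
  (exists L U : R, L < U /\ I = `]L, U[) \/ (exists w : R, I = `[w, w]).

Definition realizes (X : input) (w : elt (base X) -> R) : Prop :=
  forall i, w i \in itv i.

Definition valid_input (X : input) : Prop :=
  [/\ valid (base X), forall i, open_or_trivial (itv (i : elt (base X)))
    & realizes (@predicted X)].

(* Ties in the values may leave several correct answers; Q is feasible when
   one answer is correct for every realization agreeing with w on Q. *)
Definition feasible (X : input) (w : elt (base X) -> R)
    (Q : {set elt (base X)}) : Prop :=
  exists a : answer (base X), forall w' : elt (base X) -> R,
    realizes w' -> {in Q, w' =1 w} -> correct w' a.

(* [set: _] is only the starting point of the search for a minimum; it is
   feasible as soon as w realizes X and some answer is correct for w. *)
Definition opt (X : input) (w : elt (base X) -> R) : nat :=
  #|[arg min_(Q < [set: elt (base X)] | `[< feasible w Q >]) #|Q| ]|.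

Definition num_inaccurate (X : input) (w : elt (base X) -> R) : nat :=
  #|[set i | w i != predicted i]|.

(* The next query as a function of the input and of the queries made so far
   with the values they revealed, oldest first; None makes no further query. *)
Definition algorithm : Type :=
  forall X : input, seq (elt (base X) * R) -> option (elt (base X)).

Definition queried (X : input) (h : seq (elt (base X) * R)) :
    {set elt (base X)} := [set i in unzip1 h].

Fixpoint history (A : algorithm) (X : input) (w : elt (base X) -> R)
    (n : nat) : seq (elt (base X) * R) :=
  if n is m.+1 then
    let h := history A w m in
    if `[< feasible w (queried h) >] then h
    else if A X h is Some i then rcons h (i, w i) else h
  else [::].

(* Q is the query set of A on the instance (X, w). If A never reaches a
   feasible query set, there is no such Q. *)
Definition query_set (A : algorithm) (X : input) (w : elt (base X) -> R)
    (Q : {set elt (base X)}) : Prop :=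
  feasible w Q /\ exists n, Q = queried (history A w n).

Definition competitive_on (C : forall X : input, (elt (base X) -> R) -> Prop)
    (A : algorithm) (rho : R) : Prop :=
  forall (X : input) (w : elt (base X) -> R),
    valid_input X -> realizes w -> C X w ->
    exists Q, query_set A w Q /\ #|Q|%:R <= rho * (opt w)%:R.

Definition some_inaccurate (X : input) (w : elt (base X) -> R) : Prop :=
  (1 <= num_inaccurate w)%N.

End Uncertainty.

Section Problems.
Variable R : realType.

Record set_family := SetFamily {
  ground : finType;
  members : {set {set ground}} }.

Definition min_answer (F : set_family) : Type :=
  forall S : {set ground F}, S \in members F -> ground F.

Definition min_correct (F : set_family) (w : ground F -> R)
    (a : min_answer F) : Prop :=
  forall (S : {set ground F}) (FS : S \in members F),
    a S FS \in S /\ {in S, forall j, w (a S FS) <= w j}.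

Definition minimum_problem : problem R :=
  Problem (fun F : set_family => set0 \notin members F) min_correct.

Definition sort_answer (F : set_family) : Type :=
  forall S : {set ground F}, S \in members F -> seq (ground F).

Definition sort_correct (F : set_family) (w : ground F -> R)
    (a : sort_answer F) : Prop :=
  forall (S : {set ground F}) (FS : S \in members F),
    perm_eq (a S FS) (enum S) /\ sorted (fun i j => w i <= w j) (a S FS).

Definition sorting_problem : problem R :=
  Problem (fun _ : set_family => True) sort_correct.

Record graph := Graph {
  vertex : finType;
  edge : finType;
  ends : edge -> {set vertex} }.

Definition adj (G : graph) (F : {set edge G}) : rel (vertex G) :=
  fun u v => [exists e in F, ends e == [set u; v]].

Definition connected (G : graph) (F : {set edge G}) : Prop :=
  forall u v, connect (adj F) u v.

(* In a simple graph a cycle has at least three vertices. *)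
Definition acyclic (G : graph) (F : {set edge G}) : Prop :=
  forall c : seq (vertex G), ucycle (adj F) c -> (size c < 3)%N.

Definition simple_connected (G : graph) : Prop :=
  [/\ injective (@ends G), forall e : edge G, #|ends e| = 2%N
    & connected [set: edge G]].

Definition spanning_tree (G : graph) (F : {set edge G}) : Prop :=
  connected F /\ acyclic F.

Definition mst_correct (G : graph) (w : edge G -> R) (F : {set edge G}) :
    Prop :=
  spanning_tree F /\
  forall F' : {set edge G}, spanning_tree F' ->
    \sum_(e in F) w e <= \sum_(e in F') w e.

Definition mst_problem : problem R := Problem simple_connected mst_correct.

End Problems.

(* Main.v *)
Require Import Defs.
From mathcomp Require Import all_boot all_order all_algebra.
From mathcomp Require Import boolp reals.
From mathcomp Require Import lra.

(** Let x and y have overlapping intervals ]a, c[ and ]b, d[ with a < b and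
    c < d, both predictions lying in the overlap ]b, c[, and let a correct
    answer amount to deciding which of x and y is smaller.  As long as x or y
    is not queried and the other one is as predicted, either order is possible.
    But if x has value b, or if y has value c, then querying that single element
    decides.  The adversary mispredicts in this way an element among x and y
    that the algorithm does not query first.  For the MST problem, x and y are
    edges of a triangle whose third edge is lighter than both. *)

Set Implicit Arguments.
Unset Strict Implicit.
Unset Printing Implicit Defensive.

Import Order.TTheory GRing.Theory Num.Theory.
Local Open Scope ring_scope.

Section Queries.
Variables (R : realType) (P : problem R).
Implicit Types (X : input P) (A : algorithm P) (rho : R).

Lemma feasible_subset X (w : elt (base X) -> R) (Q Q' : {set elt (base X)}) :
  Q \subset Q' -> feasible w Q -> feasible w Q'.
Proof.
move=> /subsetP sQ [a correct_a]; exists a => w' rw' ww'.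
by apply: correct_a => // i iQ; apply/ww'/sQ.
Qed.

Lemma eq_in_feasible X (w w' : elt (base X) -> R) (Q : {set elt (base X)}) :
  {in Q, w =1 w'} -> feasible w Q -> feasible w' Q.
Proof.
move=> ww' [a correct_a]; exists a => v rv vw'.
by apply: correct_a => // i iQ; rewrite ww' ?vw'.
Qed.

Lemma opt_leq_card X (w : elt (base X) -> R) (Q : {set elt (base X)}) :
  feasible w Q -> (opt w <= #|Q|)%N.
Proof.
move=> fQ; rewrite /opt.
case: arg_minnP => [|Q' _]; last by apply; apply/asboolP.
by apply/asboolP; apply: feasible_subset (subsetT Q) fQ.
Qed.

Definition first_query A X : {set elt (base X)} :=
  [set i | A X [::] == Some i].

Lemma card_first_query A X : (#|first_query A X| <= 1)%N.
Proof.
by apply/card_le1_eqP => i j; rewrite !inE => /eqP-> /eqP[].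
Qed.

Lemma history_first_query A X (w : elt (base X) -> R) n :
  history A w n = [::] \/
  exists2 i, A X [::] = Some i & i \in queried (history A w n).
Proof.
elim: n => [|n IHn] /=; first by left.
case: ifP => // _; case: IHn => [->|[i Ai iQ]].
  by case: (A X [::]) => [i|]; [right; exists i; rewrite ?inE | left].
right; exists i => //; case: (A X _) => // j.
by move: iQ; rewrite !inE /unzip1 map_rcons mem_rcons inE => ->; rewrite orbT.
Qed.

Lemma query_set_card_gt1 A X (w : elt (base X) -> R) (Q : {set elt (base X)}) :
  ~ feasible w (first_query A X) -> query_set A w Q -> (1 < #|Q|)%N.
Proof.
move=> infeasible_first [fQ [n Qn]]; rewrite ltnNge; apply/negP => Q_le1.
apply/infeasible_first/(feasible_subset _ fQ)/subsetP => k kQ; rewrite inE.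
have [h0|[i -> iQ]] := history_first_query A w n.
  by move: kQ; rewrite Qn h0 inE.
by rewrite -Qn in iQ; rewrite ((card_le1_eqP Q_le1) k i).
Qed.

Lemma first_query_competitive_ge2 C A rho X (w : elt (base X) -> R) j :
  competitive_on C A rho -> valid_input X -> realizes w -> C X w ->
  ~ feasible w (first_query A X) -> feasible w [set j] -> 2 <= rho.
Proof.
move=> competitive_A vX rw Cw infeasible_first /opt_leq_card; rewrite cards1.
have [Q [/(query_set_card_gt1 infeasible_first) Q_gt1]] :=
  competitive_A X w vX rw Cw.
have {}Q_gt1 : (2 : R) <= #|Q|%:R by rewrite ler_nat.
by case: (opt w) => [|[|//]] Q_le _; lra.
Qed.

Definition mispredict X (z : elt (base X)) (v : R) (i : elt (base X)) : R :=
  if i == z then v else predicted i.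
#[global] Arguments mispredict X z v i /.

Lemma mispredict_realizes X (z : elt (base X)) v :
  valid_input X -> v \in itv z -> realizes (mispredict z v).
Proof. by move=> [_ _ rp] vz i /=; case: eqVneq => [->|_]. Qed.

Lemma mispredict_eq_in X (z : elt (base X)) v (Q : {set elt (base X)}) :
  z \notin Q -> {in Q, mispredict z v =1 @predicted R P X}.
Proof. by move=> zQ i iQ; rewrite /= ifN //; apply: contraNneq zQ => <-. Qed.

Lemma mispredict_some_inaccurate X (z : elt (base X)) v :
  v != predicted z -> some_inaccurate (mispredict z v).
Proof.
by move=> vz; apply/card_gt0P; exists z; rewrite inE /= eqxx.
Qed.

Definition decisive X (z : elt (base X)) : Prop :=
  exists2 v, v \in itv z & feasible (mispredict z v) [set z].

Lemma decisive_competitive_ge2 A rho X (x y : elt (base X)) :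
  valid_input X -> x != y -> decisive x -> decisive y ->
  (forall Q, feasible (@predicted R P X) Q -> (1 < #|Q|)%N) ->
  competitive_on (@some_inaccurate R P) A rho -> 2 <= rho.
Proof.
move=> vX xy dx dy predicted_card competitive_A.
have [z [v vz fz] zF] : exists2 z, decisive z & z \notin first_query A X.
  have [xF|] := boolP (x \in first_query A X); last by exists x.
  exists y => //; apply: contra_neqN xy => yF.
  exact: (card_le1_eqP (card_first_query A X)).
apply: (first_query_competitive_ge2 competitive_A vX _ _ _ fz).
- exact: mispredict_realizes.
- apply: mispredict_some_inaccurate; apply/eqP => v_pz.
  suff /predicted_card : feasible (@predicted R P X) [set z] by rewrite cards1.
  by apply: eq_in_feasible fz => i /set1P-> /=; rewrite eqxx.
- move/(eq_in_feasible (mispredict_eq_in v zF))/predicted_card.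
  by rewrite ltnNge card_first_query.
Qed.

End Queries.

Section Comparison.
Variables (R : realType) (P : problem R).
Implicit Types (X : input P) (A : algorithm P) (rho : R).

Definition encodes_comparison X (x y : elt (base X)) : Prop :=
  (exists a : answer (base X), forall w : elt (base X) -> R,
     realizes w -> w x <= w y -> correct w a) /\
  (forall a : answer (base X),
     (forall w : elt (base X) -> R, realizes w -> correct w a -> w x <= w y) \/
     (forall w : elt (base X) -> R, realizes w -> correct w a -> w y <= w x)).

Lemma encodes_comparison_feasible X (x y : elt (base X))
    (w : elt (base X) -> R) (Q : {set elt (base X)}) :
  encodes_comparison x y ->
  (forall w', realizes w' -> {in Q, w' =1 w} -> w' x <= w' y) -> feasible w Q.
Proof.
by move=> [[a correct_a] _] le_xy; exists a => w' *; apply/correct_a/le_xy.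
Qed.

Lemma feasible_comparison X (x y : elt (base X))
    (w w1 w2 : elt (base X) -> R) (Q : {set elt (base X)}) :
  encodes_comparison x y -> feasible w Q ->
  realizes w1 -> {in Q, w1 =1 w} -> realizes w2 -> {in Q, w2 =1 w} ->
  w1 x < w1 y -> w2 x <= w2 y.
Proof.
move=> [_ decides] [a correct_a] rw1 w1Q rw2 w2Q lt1.
have [le_xy|le_yx] := decides a; first exact/le_xy/correct_a.
by have := le_yx w1 rw1 (correct_a w1 rw1 w1Q); rewrite leNgt lt1.
Qed.

Section Overlap.
Variables (X : input P) (x y : elt (base X)) (a b c d : R).
Hypotheses (vX : valid_input X) (encX : encodes_comparison x y).
Hypotheses (itv_x : itv x = `]a, c[) (itv_y : itv y = `]b, d[).
Hypotheses (ab : a < b) (cd : c < d).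
Hypotheses (px : predicted x \in `]b, c[) (py : predicted y \in `]b, c[).

Lemma overlap_neq : x != y.
Proof.
apply: contraTneq ab => xy; move: itv_x; rewrite xy itv_y => -[-> _].
by rewrite ltxx.
Qed.

Lemma overlap_feasible_mem (Q : {set elt (base X)}) :
  feasible (@predicted R P X) Q -> (x \in Q) && (y \in Q).
Proof.
move=> fQ; have /negPf xy := overlap_neq.
move: ab cd px py; rewrite !in_itv /=.
move=> lt_ab lt_cd /andP[lt_bx lt_xc] /andP[lt_by lt_yc].
have order z (zNQ : z \notin Q) v1 v2 v1z v2z :=
  feasible_comparison encX fQ
    (mispredict_realizes vX v1z) (mispredict_eq_in v1 zNQ)
    (mispredict_realizes vX v2z) (mispredict_eq_in v2 zNQ).
apply/andP; split.
- apply/negPn/negP => xNQ.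
  have low_x : (b + predicted y) / 2 \in itv x by rewrite itv_x in_itv /=; lra.
  have high_x : (predicted y + c) / 2 \in itv x by rewrite itv_x in_itv /=; lra.
  suff : (predicted y + c) / 2 <= predicted y by lra.
  move: (order x xNQ _ _ low_x high_x).
  by rewrite /= eqxx eq_sym xy; apply; lra.
- apply/negPn/negP => yNQ.
  have low_y : (b + predicted x) / 2 \in itv y by rewrite itv_y in_itv /=; lra.
  have high_y : (predicted x + c) / 2 \in itv y by rewrite itv_y in_itv /=; lra.
  suff : predicted x <= (b + predicted x) / 2 by lra.
  move: (order y yNQ _ _ high_y low_y).
  by rewrite /= eqxx xy; apply; lra.
Qed.

Lemma overlap_decisive_left : decisive x.
Proof.
move: px; rewrite in_itv => /andP[px_gtb px_ltc].
exists b; first by rewrite itv_x in_itv /= ab (lt_trans px_gtb).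
apply: (encodes_comparison_feasible encX) => w rw /(_ x (set11 x)) /= wx.
by have := rw y; rewrite wx eqxx itv_y in_itv => /andP[/ltW].
Qed.

Lemma overlap_decisive_right : decisive y.
Proof.
move: py; rewrite in_itv => /andP[py_gtb py_ltc].
exists c; first by rewrite itv_y in_itv /= cd (lt_trans py_gtb).
apply: (encodes_comparison_feasible encX) => w rw /(_ y (set11 y)) /= wy.
by have := rw x; rewrite wy eqxx itv_x in_itv => /andP[_ /ltW].
Qed.

Lemma overlap_competitive_ge2 A rho :
  competitive_on (@some_inaccurate R P) A rho -> 2 <= rho.
Proof.
apply: decisive_competitive_ge2 vX overlap_neq overlap_decisive_left
  overlap_decisive_right _ => Q /overlap_feasible_mem/andP[xQ yQ].
by apply/card_gt1P; exists x, y; rewrite overlap_neq.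
Qed.

End Overlap.

End Comparison.

Section OverlapInput.
Variables (R : realType) (P : problem R) (s : structure P) (x y : elt s).

Definition overlap_itv (i : elt s) : interval R :=
  if i == x then `]0, 2[ else if i == y then `]1, 3[ else `[0, 0].

Definition overlap_input : input P :=
  @Input R P s overlap_itv (fun i => if (i == x) || (i == y) then 3 / 2 else 0).

Lemma overlap_input_valid : valid s -> valid_input overlap_input.
Proof.
move=> vs; split=> // i /=; rewrite /overlap_itv.
  case: ifP => _; last case: ifP => _; [left | left | by right; exists 0].
  - by exists 0, 2; split=> //; lra.
  - by exists 1, 3; split=> //; lra.
by case: (i == x); last case: (i == y); rewrite /= in_itv /=; lra.
Qed.

Lemma overlap_input_lt (w : elt s -> R) i :
  x != y -> realizes (X := overlap_input) w -> i != x -> i != y ->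
  (w i < w x) && (w i < w y).
Proof.
move=> /negPf xy rw /negPf ix /negPf iy.
move: (rw i) (rw x) (rw y); rewrite /= /overlap_itv ix iy eqxx eq_sym xy eqxx.
by rewrite !in_itv /=; lra.
Qed.

Lemma overlap_input_competitive_ge2 (A : algorithm P) (rho : R) :
  valid s -> x != y -> encodes_comparison (X := overlap_input) x y ->
  competitive_on (@some_inaccurate R P) A rho -> 2 <= rho.
Proof.
move=> /overlap_input_valid vX xy enc.
have itv_x : overlap_itv x = `]0, 2[ by rewrite /overlap_itv eqxx.
have itv_y : overlap_itv y = `]1, 3[.
  by rewrite /overlap_itv eq_sym (negPf xy) eqxx.
by apply: (overlap_competitive_ge2 vX enc itv_x itv_y);
  rewrite /= ?eqxx ?orbT ?in_itv /=; lra.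
Qed.

End OverlapInput.

Definition bool_family : set_family := SetFamily [set [set: bool]].

Lemma minimum_encodes_comparison (R : realType)
    (X := @overlap_input R (minimum_problem R) bool_family false true) :
  encodes_comparison (X := X) false true.
Proof.
split=> [|a].
  exists (fun _ _ => false) => w _ le_w S FS.
  by have /set1P-> := FS; split=> [|[]]; rewrite ?inE.
have setT_mem := set11 [set: bool].
case min_a: (a [set: bool] setT_mem); [right|left] => w _ /(_ _ setT_mem) [_];
  by rewrite min_a; apply; rewrite inE.
Qed.

Lemma sorting_encodes_comparison (R : realType)
    (X := @overlap_input R (sorting_problem R) bool_family false true) :
  encodes_comparison (X := X) false true.
Proof.
split=> [|a].
  exists (fun _ _ => [:: false; true]) => w _ le_w S FS.
  have /set1P-> := FS; split; last by rewrite /= le_w.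
  by apply: uniq_perm => [||[]]; rewrite ?enum_uniq ?mem_enum ?inE.
have setT_mem := set11 [set: bool].
pose pos (i : bool) := index i (a _ setT_mem).
have le_of_pos i j (w : bool -> R) :
    sort_correct (F := bool_family) w a -> (pos i <= pos j)%N -> w i <= w j.
  move=> /(_ _ setT_mem) [/perm_mem mem_a sorted_a].
  have le_w_tr : transitive (fun i j => w i <= w j).
    by move=> ? ? ?; apply: le_trans.
  by apply: (sorted_leq_index le_w_tr _ sorted_a) => [?||];
    rewrite ?lexx // mem_a mem_enum inE.
have [le_ft|le_tf] := leqP (pos false) (pos true).
- by left=> w _ correct_a; apply: le_of_pos correct_a le_ft.
- by right=> w _ correct_a; apply: le_of_pos correct_a (ltnW le_tf).
Qed.

Section Graphs.
Variable G : graph.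
Implicit Types F : {set edge G}.

Lemma adj_sym F : symmetric (adj F).
Proof. by move=> u v; apply: eq_existsb => e; rewrite setUC. Qed.

Lemma adj_ends F (e : edge G) u v :
  injective (@ends G) -> ends e = [set u; v] -> adj F u v = (e \in F).
Proof.
move=> inj_ends e_uv; rewrite /adj -e_uv.
apply/existsP/idP => [[f /andP[fF /eqP/inj_ends <-]] // | eF].
by exists e; rewrite eF /=.
Qed.

Lemma connected_star F u :
  (forall v, u != v -> adj F u v) -> connected F.
Proof.
move=> star v1 v2.
have conn_u v : connect (adj F) u v.
  by have [->|/star/connect1] := eqVneq u v.
apply: connect_trans (conn_u v2).
by rewrite (sym_connect_sym (adj_sym F)).
Qed.

Lemma connected_cover F u v :
  connected F -> u != v -> exists2 e, e \in F & u \in ends e.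
Proof.
move=> /(_ u v)/connectP[[|k p] /=]; first by move=> _ ->; rewrite eqxx.
case/andP=> /existsP[e /andP[eF /eqP e_uk]] _ _ _.
by exists e; rewrite // e_uk set21.
Qed.

End Graphs.

Lemma ler_sum_setC1 (R : realDomainType) (I : finType) (w : I -> R) (i j : I) :
  (\sum_(k in [set~ i]) w k <= \sum_(k in [set~ j]) w k) = (w j <= w i).
Proof.
have sumE l : \sum_(k in [set~ l]) w k = \sum_k w k - w l.
  rewrite [in RHS](bigD1 l) //= [in RHS]addrC addrK.
  by apply: eq_bigl => k; rewrite in_setC1.
by rewrite !sumE lerD2l lerN2.
Qed.

Definition triangle : graph := Graph (fun e : 'I_3 => [set~ e]).

Lemma triangle_ends_inj : injective (@ends triangle).
Proof. by move=> e f /setC_inj/set1_inj. Qed.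

Lemma triangle_complete (u v : 'I_3) :
  u != v -> exists e : edge triangle, ends e = [set u; v].
Proof.
move=> uv; suff /cards1P[e uvE] : #|~: [set u; v]| == 1%N.
  by exists e; rewrite /= -uvE setCK.
by rewrite -(eqn_add2l #|[set u; v]|) cardsC cards2 uv card_ord.
Qed.

Lemma triangle_ends (e u v : 'I_3) :
  uniq [:: e; u; v] -> ends (e : edge triangle) = [set u; v].
Proof.
rewrite /= !inE negb_or andbT => /andP[/andP[eu ev] uv].
apply/esym/eqP; rewrite eqEcard cardsC1 card_ord cards2 uv.
by rewrite subUset !sub1set !inE ![_ == e]eq_sym eu ev.
Qed.

Lemma triangle_cycle_full (F : {set edge triangle}) (p : seq 'I_3) :
  ucycle (adj F) p -> (2 < size p)%N -> F = [set: edge triangle].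
Proof.
move=> cyc_p p_gt2; have uniq_p : uniq p by case/andP: cyc_p.
have [size_p p_full] : (size p = size (enum 'I_3)) * (p =i enum 'I_3).
  by apply: uniq_min_size => // [u|]; rewrite ?mem_enum ?size_enum_ord.
apply/setP => e; rewrite inE.
have /rot_to[i q rot_p] : e \in p by rewrite p_full mem_enum.
move: cyc_p size_p; rewrite -(rot_ucycle i) -(size_rot i) size_enum_ord rot_p.
case: q {rot_p} => [|u [|v []]] //= /andP[/and4P[_ uv_F _ _] uniq_euv] _.
by rewrite -(adj_ends F triangle_ends_inj (triangle_ends uniq_euv)).
Qed.

Lemma triangle_setT_adj (u v : 'I_3) :
  u != v -> adj [set: edge triangle] u v.
Proof.
case/triangle_complete => e e_uv.
by rewrite (adj_ends _ triangle_ends_inj e_uv) inE.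
Qed.

Lemma triangle_simple : simple_connected triangle.
Proof.
split=> [|e|]; first exact: triangle_ends_inj.
  by rewrite cardsC1 card_ord.
by apply: (@connected_star triangle _ ord0) => v; apply: triangle_setT_adj.
Qed.

Lemma triangle_setT_not_acyclic : ~ acyclic [set: edge triangle].
Proof.
move=> acyc; have := acyc (enum 'I_3); rewrite size_enum_ord /ucycle enum_uniq.
by rewrite !enum_ordSl enum_ord0 /= !triangle_setT_adj // => /(_ isT).
Qed.

Lemma triangle_connected_setC1 (F : {set edge triangle}) (e : 'I_3) :
  connected F -> e \notin F -> F = [set~ e].
Proof.
move=> connF eF; apply/eqP; rewrite eqEsubset; apply/andP; split.
  by rewrite subsetC sub1set inE.
apply/subsetP => f; rewrite !inE => /triangle_complete[v v_fe].
have [f_v e_v] : f != v /\ e != v.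
  by split; [have := set21 f e | have := set22 f e]; rewrite -v_fe !inE.
have [] := connected_cover connF (_ : v != f); first by rewrite eq_sym.
move=> t tF; rewrite inE => vt.
have : t \in ends v by rewrite !inE eq_sym -in_setC1 inE.
by rewrite v_fe !inE => /orP[] /eqP tE; move: tF; rewrite tE ?(negPf eF).
Qed.

Lemma triangle_setC1_spanning_tree (e : 'I_3) :
  spanning_tree ([set~ e] : {set edge triangle}).
Proof.
split=> [|p cyc_p]; last first.
  rewrite ltnNge; apply/negP => /(triangle_cycle_full cyc_p)/setP/(_ e).
  by rewrite !inE eqxx.
apply: (@connected_star triangle _ e) => v /triangle_complete[f f_ev].
rewrite (adj_ends _ triangle_ends_inj f_ev) in_setC1 eq_sym -in_setC1.
by rewrite [[set~ f]]f_ev set21.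
Qed.

Lemma triangle_spanning_treeP (F : {set edge triangle}) :
  spanning_tree F <-> exists e, F = [set~ e].
Proof.
split=> [[connF acycF]|[e ->]]; last exact: triangle_setC1_spanning_tree.
have /subsetPn[e _ eF] : ~~ ([set: edge triangle] \subset F).
  rewrite subTset; apply/eqP => F_setT; rewrite F_setT in acycF.
  exact: triangle_setT_not_acyclic.
by exists e; apply: triangle_connected_setC1.
Qed.

Lemma triangle_mst_correctP (R : realType) (w : edge triangle -> R)
    (F : {set edge triangle}) :
  mst_correct w F <-> exists2 e, F = [set~ e] & forall f, w f <= w e.
Proof.
split=> [[/triangle_spanning_treeP[e ->] min_F]|[e -> max_e]].
  exists e => // f; rewrite -ler_sum_setC1.
  by apply/min_F/triangle_spanning_treeP; exists f.
split=> [|_ /triangle_spanning_treeP[f ->]]; last by rewrite ler_sum_setC1.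
by apply/triangle_spanning_treeP; exists e.
Qed.

Lemma mst_encodes_comparison (R : realType) (x y : edge triangle)
    (X := @overlap_input R (mst_problem R) triangle x y) :
  x != y -> encodes_comparison (X := X) x y.
Proof.
move=> xy.
have others_lt w f := @overlap_input_lt R (mst_problem R) triangle x y w f xy.
have le_max (w : 'I_3 -> R) (e f : 'I_3) :
    realizes (X := X) w -> w x <= w e -> w y <= w e -> w f <= w e.
  move=> rw xe ye.
  have [-> //|fx] := eqVneq f x; have [-> //|fy] := eqVneq f y.
  by have /andP[/ltW/le_trans->] := others_lt _ _ rw fx fy.
split=> [|F].
  exists ([set~ y] : {set edge triangle}) => w rw le_xy.
  by apply/triangle_mst_correctP; exists y => // f; apply: le_max.
have [yF|yF] := boolP (y \in (F : {set edge triangle})); [right|left].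
  move=> w rw /triangle_mst_correctP[e FE max_e]; move: yF (max_e y).
  rewrite FE in_setC1 eq_sym => ey; have [-> //|ex] := eqVneq e x.
  by have /andP[_ lt_ey] := others_lt _ _ rw ex ey; rewrite leNgt lt_ey.
move=> w rw /triangle_mst_correctP[e FE max_e].
by move: yF; rewrite FE !inE negbK => /eqP->.
Qed.

Theorem theorem13 (R : realType) :
  [/\ forall (A : algorithm (minimum_problem R)) (rho : R),
        competitive_on (@some_inaccurate R (minimum_problem R)) A rho -> 2 <= rho,
      forall (A : algorithm (sorting_problem R)) (rho : R),
        competitive_on (@some_inaccurate R (sorting_problem R)) A rho -> 2 <= rho
    & forall (A : algorithm (mst_problem R)) (rho : R),
        competitive_on (@some_inaccurate R (mst_problem R)) A rho -> 2 <= rho].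
Proof.
split=> A rho.
- apply: overlap_input_competitive_ge2 (minimum_encodes_comparison R) => //=.
  by rewrite inE eq_sym; apply/set0Pn; exists true; rewrite inE.
- exact: overlap_input_competitive_ge2 (sorting_encodes_comparison R).
- have neq_edges : (0 : edge triangle) != 1 by [].
  have encodes := mst_encodes_comparison R neq_edges.
  by apply: overlap_input_competitive_ge2 encodes => //; apply: triangle_simple.
Qed.
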